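(* Let $n\ge 2$, $\alpha,\beta\ge 0$, $\lambda,\lambda_0>0$ and $\mu,\mu_0>0$. Let $\{G_t=(V,E_t),\,t\ge0\}$ be the stationary network Markov chain on graphs with vertex set $V=\{1,\dots,n\}$ with these parameters (see context), and let $e=\mathbf{E}\left[\binom n2^{-1}|E_t|\right]$ be the average edge density at stationarity (it does not depend on $t$). Then: (a) $\displaystyle e\ge\frac{\lambda_0}{\lambda_0+\mu_0}$. (b) If $\alpha,\beta\ge2$, then $\displaystyle e\le\frac{\lambda_0+\frac1{n-1}\max\{\lambda,\mu\}}{\lambda_0+\mu_0}$. (c) If $\alpha,\beta\ge1$ and $\lambda_0+\mu_0>\max\{\lambda,\mu\}$, then $\displaystyle e\le\frac{\lambda_0}{\lambda_0+\mu_0-\max\{\lambda,\mu\}}$.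
   Context: For a graph $G=(V,E)$ and distinct $i,j\in V$ let $N_{ij}(G)$ be the set of common neighbours of $i$ and $j$ in $G$, let $d_v(G)$ be the degree of $v$ in $G$, and for $s\ge0$ let $$\nu_{ij}(G,s)=\sum_{v\in N_{ij}(G)}(d_v(G))^{-s}.$$ The network Markov chain is the continuous time Markov chain whose states are the graphs on $V$ and in which, from the state $G=(V,E)$, each pair $\{i,j\}\subset V$ toggles its adjacency status (the edge is inserted if absent and removed if present) at rate $$a_{ij}(G)=\begin{cases}\lambda_0+\lambda\,\nu_{ij}(G,\alpha)&\text{for }\{i,j\}\notin E,\\ \left(\mu_0-\mu\,\nu_{ij}(G,\beta)\right)_+&\text{for }\{i,j\}\in E,\end{cases}$$ where $x_+=\max\{x,0\}$. That is, given the current state, the pairs are assigned independent exponential waiting times with intensities $a_{ij}(G)$ and the pair with the smallest waiting time toggles its status. This chain has a unique stationary distribution; the stationary chain is the one whose initial state $G_0$ has this distribution. *)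

(* Defs.v *)
From HB Require Import structures.
From mathcomp Require Import all_boot all_order all_algebra.
From mathcomp Require Import all_classical all_reals all_analysis.

Set Implicit Arguments.
Unset Strict Implicit.
Unset Printing Implicit Defensive.

Import Order.TTheory GRing.Theory Num.Theory.
Import numFieldNormedType.Exports.

Local Open Scope classical_set_scope.
Local Open Scope ring_scope.

(* The vertex set {1, ..., n} is 'I_n.  A pair is a two-element set of vertices
   and a graph is identified with its edge set, so that the (finite) state
   space consists exactly of the simple graphs on 'I_n. *)
Definition vpair (n : nat) := {e : {set 'I_n} | #|e| == 2%N}.
Definition graph (n : nat) := {set vpair n}.

Definition adj (n : nat) (G : graph n) : rel 'I_n :=
  fun u v => [exists e in G, val e == [set u; v]%SET].

Definition vdeg (n : nat) (G : graph n) (v : 'I_n) : nat :=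
  #|[set u | adj G v u]%SET|.

Definition common_nbrs (n : nat) (G : graph n) (e : vpair n) : {set 'I_n} :=
  [set v | [forall u in val e, adj G u v]]%SET.

Definition nu (R : realType) (n : nat) (G : graph n) (e : vpair n) (s : R) : R :=
  \sum_(v in common_nbrs G e) (vdeg G v)%:R `^ (- s).

Definition toggle_rate (R : realType) (n : nat)
    (alpha beta lambda0 lambda mu0 mu : R) (G : graph n) (e : vpair n) : R :=
  if e \in G then Num.max (mu0 - mu * nu G e beta) 0
  else lambda0 + lambda * nu G e alpha.

Definition toggle (n : nat) (G : graph n) (e : vpair n) : graph n :=
  if e \in G then (G :\ e)%SET else (e |: G)%SET.

(* The off-diagonal sum has at most one term, since the graphs [toggle G e]
   are pairwise distinct. *)
Definition network_generator (R : realType) (n : nat)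
    (alpha beta lambda0 lambda mu0 mu : R) (G H : graph n) : R :=
  if G == H then - \sum_e toggle_rate alpha beta lambda0 lambda mu0 mu G e
  else \sum_(e | toggle G e == H)
         toggle_rate alpha beta lambda0 lambda mu0 mu G e.

Definition edge_density (R : realType) (n : nat) (G : graph n) : R :=
  ('C(n, 2)%:R)^-1 * #|G|%:R.

(* Continuous time Markov chains on a finite state space S.  Time is
   represented by R; only nonnegative times are ever constrained. *)

Definition transition_function (R : realType) (S : finType)
    (p : R -> S -> S -> R) : Prop :=
  [/\ forall (t : R) x y, 0 <= t -> 0 <= p t x y,
      forall (t : R) x, 0 <= t -> \sum_y p t x y = 1,
      forall x y, p 0 x y = (x == y)%:R &
      forall (s t : R) x y, 0 <= s -> 0 <= t ->
        p (s + t) x y = \sum_z p s x z * p t z y].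

(* q x y is the rate of the jumps from x to y, for x != y. *)
Definition has_generator (R : realType) (S : finType)
    (p : R -> S -> S -> R) (q : S -> S -> R) : Prop :=
  forall x y, (p h x y - (x == y)%:R) / h @[h --> 0^'+] --> q x y.

Definition stationary_distribution (R : realType) (S : finType)
    (p : R -> S -> S -> R) (pi : S -> R) : Prop :=
  [/\ forall x, 0 <= pi x,
      \sum_x pi x = 1 &
      forall (t : R) y, 0 <= t -> \sum_x pi x * p t x y = pi y].

(* X is a right-continuous process with the Markov property
     P(X_{t+h} = y | X_t = x, X_{s_1} = x_1, ..., X_{s_k} = x_k) = p h x y
   for all past times s_1, ..., s_k in [0, t]; the list past consists of the
   pairs (s_i, x_i), and the conditional probability is multiplied out. *)
Definition markov_chain (R : realType) (d : measure_display)
    (Omega : measurableType d) (P : probability Omega R) (S : finType)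
    (p : R -> S -> S -> R) (X : R -> Omega -> S) : Prop :=
  [/\ forall (t : R) x, 0 <= t -> measurable (X t @^-1` [set x]),
      forall w (t : R), 0 <= t -> \forall s \near t^'+, X s w = X t w &
      forall (t h : R) (x y : S) (past : seq (R * S)),
        0 <= t -> 0 <= h -> (forall r, r \in past -> 0 <= r.1 <= t) ->
        let history :=
          [set w | X t w = x /\ forall r, r \in past -> X r.1 w = r.2] in
        P (history `&` [set w | X (t + h) w = y]) =
          (P history * (p h x y)%:E)%E].

Definition stationary_chain (R : realType) (d : measure_display)
    (Omega : measurableType d) (P : probability Omega R) (S : finType)
    (q : S -> S -> R) (X : R -> Omega -> S) : Prop :=
  exists (p : R -> S -> S -> R) (pi : S -> R),
    [/\ transition_function p, has_generator p q, markov_chain P p X,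
        stationary_distribution p pi &
        forall x, P (X 0 @^-1` [set x]) = (pi x)%:E].

(* Main.v *)
Require Import Defs.
From mathcomp Require Import all_boot all_order all_algebra.
From mathcomp Require Import all_classical all_reals all_analysis.
From mathcomp Require Import measurable_realfun ring lra.
Import Order.TTheory GRing.Theory Num.Theory.
Import numFieldNormedType.Exports.
Local Open Scope classical_set_scope.
Local Open Scope ring_scope.

(** Stationarity makes the mean of the generator applied to |E| vanish:
  E[ \sum_(e \notin G) (lambda0 + lambda nu_e(alpha))
     - \sum_(e \in G) (mu0 - mu nu_e(beta))_+ ] = 0.
Dropping the nu terms gives (a).  For the upper bounds, drop the positive part
and replace lambda, mu by their maximum and alpha, beta by s = 2 or s = 1; then
only \sum_e nu_e(s) <= \sum_v 'C(d_v, 2) d_v^(-s) matters, which is at most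
n / 2 for s = 2 and, by the handshake lemma, at most |E| for s = 1. *)

(** * Stationarity, laws and expectations on a finite state space *)

Lemma stationary_generator (R : realType) (S : finType) (p : R -> S -> S -> R)
    (q : S -> S -> R) (pi : S -> R) :
  has_generator p q -> stationary_distribution p pi ->
  forall y, \sum_x pi x * q x y = 0.
Proof.
move=> hq [_ _ hpi] y.
(* The sum below is the difference quotient at 0 of the map sending h to [\sum_x pi x * p h x y]. By
   stationarity that map is constant, so the quotient vanishes for every h > 0, and uniqueness of
   limits finishes. *)
have lim_q : \sum_x pi x * ((p h x y - (x == y)%:R) / h) @[h --> 0^'+] -->
    \sum_x pi x * q x y.
  apply: cvg_big => [|x _]; first exact: add_continuous.
  by apply: cvgMl_tmp; exact: hq.
apply: (cvg_unique _ lim_q); first exact: norm_hausdorff.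
apply: cvg_near_cst; near=> h.
under eq_bigr do rewrite mulrA mulrBr.
rewrite -mulr_suml sumrB hpi; last by near: h; exact: nbhs_right_ge.
rewrite (bigD1 y) //= eqxx mulr1 big1 ?addr0 ?subrr ?mul0r//.
by move=> x /negbTE ->; rewrite mulr0.
Unshelve. all: by end_near. Qed.

Lemma stationary_generator_mean (R : realType) (S : finType)
    (p : R -> S -> S -> R) (q : S -> S -> R) (pi f : S -> R) :
  has_generator p q -> stationary_distribution p pi ->
  \sum_x pi x * \sum_y q x y * f y = 0.
Proof.
move=> hq hpi.
under eq_bigr do rewrite mulr_sumr.
rewrite exchange_big big1 //= => y _.
under eq_bigr do rewrite mulrA.
by rewrite -mulr_suml (stationary_generator _ _ _ _ _ hq hpi) mul0r.
Qed.

(** The indicator of [B] splits as a finite sum over the fibres of [X]. Measurability is required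
    fibre by fibre because [S] carries no sigma-algebra. *)
Lemma total_probability (R : realType) (d : measure_display)
    (Omega : measurableType d) (P : probability Omega R) (S : finType)
    (X : Omega -> S) (B : set Omega) :
  (forall x, measurable (X @^-1` [set x])) -> measurable B ->
  P B = (\sum_x P (X @^-1` [set x] `&` B))%E.
Proof.
move=> mX mB.
have mXB x : measurable (X @^-1` [set x] `&` B) by exact: measurableI.
rewrite -{1}(setIT B) -integral_indic//.
under [RHS]eq_bigr do rewrite -[_ `&` B]setIT -integral_indic//.
rewrite -ge0_integral_sum//; last first.
  by move=> x; apply/measurable_EFinP; exact: measurable_indic.
apply: eq_integral => w _; rewrite sumEFin; congr (_%:E).
rewrite (bigD1 (X w)) //= big1 ?addr0.
  by rewrite indicI /= [X in X * _]indicE mem_set// mul1r.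
by move=> x xX; rewrite indicE memNset//= => -[/= h _]; rewrite h eqxx in xX.
Qed.

(** Condition on the state at time 0: the Markov property with an empty past gives the joint law of
    [X 0] and [X t], and summing over the initial state yields [pi] again by invariance. *)
Lemma stationary_chain_law (R : realType) (d : measure_display)
    (Omega : measurableType d) (P : probability Omega R) (S : finType)
    (p : R -> S -> S -> R) (pi : S -> R) (X : R -> Omega -> S) :
  markov_chain P p X -> stationary_distribution p pi ->
  (forall x, P (X 0 @^-1` [set x]) = (pi x)%:E) ->
  forall t y, 0 <= t -> P (X t @^-1` [set y]) = (pi y)%:E.
Proof.
move=> [mX _ markov] [_ _ hpi] hX0 t y t0.
rewrite (@total_probability _ _ _ _ _ (X 0)); first last.
- exact: mX.
- by move=> x; exact: mX.
rewrite -(hpi t) // -sumEFin; apply: eq_bigr => x _.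
have := markov 0 t x y [::] (lexx 0) t0 (fun r => ltac:(by [])).
rewrite add0r EFinM -hX0 /=.
have -> : [set w | X 0 w = x /\ forall r : R * S, r \in [::] -> X r.1 w = r.2]
    = X 0 @^-1` [set x].
  by apply/seteqP; split => w /=; [case | split].
by [].
Qed.

(** [f (X w)] is a finite combination of indicators of fibres; since [f] is nonnegative, sum and
    integral commute with no integrability argument. *)
Lemma expectation_finite (R : realType) (d : measure_display)
    (Omega : measurableType d) (P : probability Omega R) (S : finType)
    (X : Omega -> S) (pi f : S -> R) :
  (forall x, measurable (X @^-1` [set x])) ->
  (forall x, P (X @^-1` [set x]) = (pi x)%:E) -> (forall x, 0 <= f x) ->
  ('E_P[fun w => f (X w)] = (\sum_x pi x * f x)%:E)%E.
Proof.
move=> mX hX f0.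
rewrite unlock -sumEFin.
transitivity (\int[P]_w (\sum_x ((f x)%:E * (\1_(X @^-1` [set x]) w)%:E)))%E.
  apply: eq_integral => w _; rewrite (bigD1 (X w)) //= big1 ?adde0.
    by rewrite indicE mem_set// mule1.
  by move=> x xX; rewrite indicE memNset ?mule0//= => h; rewrite h eqxx in xX.
have mI x : measurable_fun [set: Omega] (fun w => (\1_(X @^-1` [set x]) w : R)%:E).
  by apply/measurable_EFinP; exact: measurable_indic.
rewrite ge0_integral_sum//; last first.
- by move=> x w _; rewrite mule_ge0 ?lee_fin.
- by move=> x; apply: measurable_funeM.
apply: eq_bigr => x _; rewrite ge0_integralZl//.
- rewrite integral_indic// setIT EFinM muleC; congr (_ * _)%E; exact: hX.
- by rewrite lee_fin.
Qed.

(** * The generator applied to the number of edges *)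

Lemma card_vpair (n : nat) : #|{: vpair n}| = 'C(n, 2).
Proof. by rewrite card_sig -cardsE card_draws card_ord. Qed.

Lemma toggleN (n : nat) (G : graph n) e : (toggle G e == G) = false.
Proof.
rewrite /toggle; case: ifPn => eG; apply/negP => /eqP/setP/(_ e).
  by rewrite !inE eqxx eG.
by rewrite !inE eqxx (negbTE eG).
Qed.

(** The diagonal entry supplies the [- f G] terms. The off-diagonal entries are the pairs grouped by
    their target [toggle G e], which by [toggleN] is never [G], so every pair is counted exactly
    once. *)
Lemma generator_action (R : realType) (n : nat)
    (alpha beta lambda0 lambda mu0 mu : R) (G : graph n) (f : graph n -> R) :
  \sum_H network_generator alpha beta lambda0 lambda mu0 mu G H * f H =
  \sum_e toggle_rate alpha beta lambda0 lambda mu0 mu G e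
           * (f (toggle G e) - f G).
Proof.
set r := toggle_rate _ _ _ _ _ _ _.
under [RHS]eq_bigr do rewrite mulrBr.
rewrite sumrB -mulr_suml (bigD1 G)//= /network_generator eqxx mulNr addrC.
congr (_ - _).
rewrite [RHS](partition_big (toggle G) (fun H => H != G)) /=; last first.
  by move=> e _; rewrite toggleN.
apply: eq_bigr => H; rewrite eq_sym => /negbTE ->; rewrite mulr_suml.
by apply: eq_bigr => e /eqP ->.
Qed.

Lemma generator_size (R : realType) (n : nat)
    (alpha beta lambda0 lambda mu0 mu : R) (G : graph n) :
  \sum_H network_generator alpha beta lambda0 lambda mu0 mu G H * #|H|%:R =
  \sum_(e | e \notin G) (lambda0 + lambda * nu G e alpha)
  - \sum_(e in G) Num.max (mu0 - mu * nu G e beta) 0.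
Proof.
rewrite generator_action (bigID (fun e => e \in G)) /= addrC; congr (_ + _).
  apply: eq_bigr => e eG; rewrite /toggle_rate /toggle (negbTE eG) cardsU1 eG.
  by rewrite natrD addrK mulr1.
rewrite -sumrN; apply: eq_bigr => e eG.
by rewrite /toggle_rate /toggle eG [in #|G|](cardsD1 e) eG add1n -natr1; ring.
Qed.

(** * Summing the common-neighbour weights over all pairs *)

Lemma nu_ge0 (R : realType) (n : nat) (G : graph n) e (s : R) : 0 <= nu G e s.
Proof. by apply: sumr_ge0 => v _; exact: powR_ge0. Qed.

(** If [v] is adjacent to both ends of [e], then [val e] is a two-element subset of the
    neighbourhood of [v]. *)
Lemma common_nbrs_count (n : nat) (G : graph n) (v : 'I_n) :
  (#|[set e | v \in common_nbrs G e]%SET| <= 'C(vdeg G v, 2))%N.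
Proof.
rewrite -cards_draws -(card_imset _ val_inj); apply/subset_leq_card/fintype.subsetP.
move=> _ /imsetP[e + ->]; rewrite !inE => /forall_inP h.
rewrite (valP e) andbT; apply/fintype.subsetP => u ue; rewrite !inE /adj.
have := h u ue; rewrite /adj => /exists_inP[e' e'G /eqP e'E].
by apply/exists_inP; exists e' => //; rewrite e'E finset.setUC.
Qed.

Lemma handshake_le (n : nat) (G : graph n) :
  (\sum_v vdeg G v <= #|G| * 2)%N.
Proof.
have deg_le v : (vdeg G v <= \sum_(e in G) (v \in val e))%N.
  (* [B e] holds the other end of [e] when [e] contains [v], and is empty otherwise. These sets
     cover the neighbours of [v], and each has at most one element. *)
  pose B (e : vpair n) := (if v \in val e then val e :\ v else finset.set0)%SET.
  apply: (@leq_trans (\sum_(e in G) #|B e|)%N).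
    apply: (@leq_trans #|(\bigcup_(e in G) B e)%SET|).
      apply/subset_leq_card/fintype.subsetP => u.
      rewrite inE => /exists_inP[e eG /eqP eE].
      apply/finset.bigcupP; exists e => //.
      rewrite /B eE !inE eqxx /= !inE eqxx orbT andbT.
      by apply/eqP => uv; have := valP e; rewrite eE uv finset.setUid cards1.
    elim/big_rec2: _ => [|e A m _ IH]; first by rewrite cards0.
    by apply: leq_trans (leq_card_setU _ _) _; rewrite leq_add2l.
  apply: leq_sum => e _; rewrite /B; case: ifPn => ve; last by rewrite cards0.
  by have := valP e; rewrite (cardsD1 v) ve add1n => /eqP[->].
apply: (leq_trans (leq_sum _ (fun v _ => deg_le v))).
rewrite exchange_big /= -sum_nat_const; apply: leq_sum => e eG.
have /eqP := valP e; rewrite -sum1_card => {2}<-.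
by rewrite [leqRHS]big_mkcond.
Qed.

(** Double counting: after exchanging the sums, the weight of [v] appears once for each pair having
    [v] as a common neighbour. *)
Lemma sum_nu_le (R : realType) (n : nat) (G : graph n) (s : R) :
  \sum_e nu G e s <= \sum_v ('C(vdeg G v, 2))%:R * (vdeg G v)%:R `^ (- s).
Proof.
rewrite (exchange_big_dep xpredT) //=; apply: ler_sum => v _.
rewrite sumr_const -[leLHS]mulr_natl ler_wpM2r ?powR_ge0// ler_nat.
by rewrite -cardsE common_nbrs_count.
Qed.

Lemma bin2_natr (R : realType) (d : nat) :
  'C(d, 2)%:R = d%:R * (d%:R - 1) / 2 :> R.
Proof.
have /(congr1 (fun k => k%:R : R)) : ('C(d, 2) * 2 = d * d.-1)%N.
  by have := mul_bin_left d 1; rewrite bin1 subn1 mulnC => ->; rewrite mulnC.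
(* At 0 the truncated predecessor differs from [d - 1], but the factor [d] makes both sides
   vanish. *)
case: d => [|d]; first by rewrite !mul0r.
by rewrite !natrM /= -[d.+1%:R]natr1 => h; lra.
Qed.

Lemma nu_antimono (R : realType) (n : nat) (G : graph n) e (r s : R) :
  0 < r -> r <= s -> nu G e s <= nu G e r.
Proof.
move=> r0 rs; apply: ler_sum => v _.
(* A positive degree is a base at least 1, so the power decreases as the exponent grows. At degree 0
   both powers are 0, their exponents being nonzero because [0 < r]. *)
case: (vdeg G v) => [|k]; last by rewrite ler_powR ?ler1n ?lerN2.
by rewrite !powR0// oppr_eq0 gt_eqF// (lt_le_trans r0).
Qed.

(** A vertex of degree d > 0 contributes (d - 1) / (2 d), which is at most 1/2. *)
Lemma sum_nu2_le (R : realType) (n : nat) (G : graph n) :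
  \sum_e nu G e 2 <= n%:R / 2 :> R.
Proof.
apply: le_trans (sum_nu_le _ _ _ _) _.
have -> : n%:R / 2 = \sum_(v < n) 2^-1 :> R.
  by rewrite sumr_const card_ord mulr_natl.
apply: ler_sum => v _.
rewrite powRN powR_mulrn// bin2_natr.
case: (vdeg G v) => [|k]; first by rewrite !mul0r.
have k0 : 0 < k.+1%:R :> R by rewrite ltr0n.
by rewrite ler_pdivrMr ?exprn_gt0//; nra.
Qed.

(** A vertex of degree d > 0 contributes (d - 1) / 2, which is at most d / 2; the degrees sum to at
    most twice the number of edges. *)
Lemma sum_nu1_le (R : realType) (n : nat) (G : graph n) :
  \sum_e nu G e 1 <= #|G|%:R :> R.
Proof.
apply: le_trans (sum_nu_le _ _ _ _) _.
apply: (@le_trans _ _ ((\sum_v vdeg G v)%:R / 2)); last first.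
  by rewrite ler_pdivrMr// -natrM ler_nat handshake_le.
rewrite natr_sum mulr_suml; apply: ler_sum => v _.
rewrite powRN powRr1// bin2_natr.
case: (vdeg G v) => [|k]; first by rewrite !mul0r.
have k0 : 0 < k.+1%:R :> R by rewrite ltr0n.
by rewrite ler_pdivrMr//; nra.
Qed.

(** * Bounds on the drift of the edge count, and the density estimates *)

Lemma sum_notin_const (R : realType) (n : nat) (G : graph n) (a : R) :
  \sum_(e | e \notin G) a = a * ('C(n, 2)%:R - #|G|%:R).
Proof.
have := cardC (mem G); rewrite card_vpair => /(congr1 (fun k => k%:R : R)).
rewrite sumr_const natrD => <-; rewrite addrAC subrr add0r mulr_natr.
by congr (_ *+ _); apply: eq_card.
Qed.

(** The bound is affine in the edge count, so averaging it over [pi] leaves a relation in the mean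
    edge count alone. *)
Lemma generator_size_ge (R : realType) (n : nat)
    (alpha beta lambda0 lambda mu0 mu : R) (G : graph n) :
  0 < lambda -> 0 < mu -> 0 < mu0 ->
  lambda0 * 'C(n, 2)%:R - (lambda0 + mu0) * #|G|%:R <=
  \sum_H network_generator alpha beta lambda0 lambda mu0 mu G H * #|H|%:R.
Proof.
move=> l0 m0 m00; rewrite generator_size.
have -> : lambda0 * 'C(n, 2)%:R - (lambda0 + mu0) * #|G|%:R =
    \sum_(e | e \notin G) lambda0 - \sum_(e in G) mu0.
  by rewrite sum_notin_const sumr_const -mulr_natr; ring.
apply: lerB; apply: ler_sum => e _.
  by rewrite lerDl mulr_ge0 ?nu_ge0// ltW.
by rewrite ge_max (ltW m00) andbT gerBl mulr_ge0 ?nu_ge0// ltW.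
Qed.

(** With a common coefficient and a common exponent, the [nu] terms of edges and non-edges enter
    with the same sign and merge into one sum over all pairs. *)
Lemma generator_size_le (R : realType) (n : nat)
    (alpha beta lambda0 lambda mu0 mu s : R) (G : graph n) :
  0 < lambda -> 0 < mu -> 0 < s -> s <= alpha -> s <= beta ->
  \sum_H network_generator alpha beta lambda0 lambda mu0 mu G H * #|H|%:R <=
  lambda0 * 'C(n, 2)%:R - (lambda0 + mu0) * #|G|%:R
  + Num.max lambda mu * \sum_e nu G e s.
Proof.
move=> l0 m0 s0 sa sb; rewrite generator_size.
set M := Num.max lambda mu.
have -> : lambda0 * 'C(n, 2)%:R - (lambda0 + mu0) * #|G|%:R
    + M * \sum_e nu G e s =
    \sum_(e | e \notin G) (lambda0 + M * nu G e s)
    - \sum_(e in G) (mu0 - M * nu G e s).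
  rewrite big_split sumrB /= sum_notin_const sumr_const -mulr_natr -!mulr_sumr.
  by rewrite [\sum_e _](bigID (fun e => e \in G)) /=; ring.
have nuM (c r : R) e : 0 < c -> c <= M -> s <= r -> c * nu G e r <= M * nu G e s.
  by move=> c0 cM sr; apply: ler_pM; rewrite ?nu_ge0 ?nu_antimono// ltW.
apply: lerB; apply: ler_sum => e _.
  by rewrite lerD2l nuM// le_max lexx.
by rewrite le_max lerD2l lerN2 nuM// le_max lexx orbT.
Qed.

Theorem mainTheorem4 (R : realType) (n : nat) (hn : (2 <= n)%N)
    (alpha beta lambda0 lambda mu0 mu : R)
    (halpha : 0 <= alpha) (hbeta : 0 <= beta)
    (hlambda : 0 < lambda) (hlambda0 : 0 < lambda0)
    (hmu : 0 < mu) (hmu0 : 0 < mu0)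
    (d : measure_display) (Omega : measurableType d) (P : probability Omega R)
    (G : R -> Omega -> graph n)
    (hG : stationary_chain P
            (@network_generator R n alpha beta lambda0 lambda mu0 mu) G) :
  exists e : R,
    (forall t : R, 0 <= t -> ('E_P[fun w => edge_density R (G t w)] = e%:E)%E) /\
    [/\ lambda0 / (lambda0 + mu0) <= e,
        2 <= alpha -> 2 <= beta ->
          e <= (lambda0 + (n%:R - 1)^-1 * Num.max lambda mu) / (lambda0 + mu0) &
        1 <= alpha -> 1 <= beta -> Num.max lambda mu < lambda0 + mu0 ->
          e <= lambda0 / (lambda0 + mu0 - Num.max lambda mu)].
Proof.
have [p [pi [_ hq hmarkov hpi hG0]]] := hG.
have [pi0 pi1 _] := hpi.
(* The mean density under [pi], which is the law of the chain at every time t >= 0. *)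
exists (\sum_x pi x * edge_density R x); split.
  move=> t t0; apply: expectation_finite.
  - by case: hmarkov => mG _ _ x; exact: mG.
  - by move=> x; exact: (stationary_chain_law _ _ _ _ _ _ _ _ hmarkov hpi hG0).
  - by move=> x; rewrite mulr_ge0 ?invr_ge0.
set m := \sum_x pi x * #|x|%:R.
have -> : \sum_x pi x * edge_density R x = m / 'C(n, 2)%:R.
  rewrite mulr_suml; apply: eq_bigr => x _.
  by rewrite /edge_density -mulrA [X in _ * X]mulrC.
have balance := stationary_generator_mean _ _ _ _ _ (fun x : graph n => #|x|%:R) hq hpi.
have N0 : 0 < 'C(n, 2)%:R :> R by rewrite ltr0n bin_gt0.
have mean_affine (a b : R) :
    \sum_x pi x * (a - b * #|x|%:R) = a - b * m.
  rewrite /m mulr_sumr -[in RHS](mulr1 a) -pi1 mulr_sumr -sumrB.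
  by apply: eq_bigr => x _; ring.
have mean_le (f g : graph n -> R) : (forall x, f x <= g x) ->
    \sum_x pi x * f x <= \sum_x pi x * g x.
  by move=> fg; apply: ler_sum => x _; rewrite ler_wpM2l.
have M0 : 0 < Num.max lambda mu by rewrite lt_max hlambda.
set M := Num.max lambda mu in M0 *.
(* One estimate serves both upper bounds: (s, c, k) is (2, n/2, 0) for (b) and (1, 0, 1) for (c).
   The 0 on the left is the stationary mean of the drift. *)
have upper (s c k : R) : 0 < s -> s <= alpha -> s <= beta ->
    (forall x : graph n, \sum_e nu x e s <= c + k * #|x|%:R) ->
    0 <= lambda0 * 'C(n, 2)%:R + M * c - (lambda0 + mu0 - M * k) * m.
  move=> s0 sa sb hnu; rewrite -mean_affine -[leLHS]balance; apply: mean_le => x.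
  apply: le_trans (generator_size_le _ _ _ _ _ _ _ _ s _ _ _ _ _ _) _ => //.
  have := ler_wpM2l (ltW M0) (hnu x); rewrite -/M; lra.
split.
- have : lambda0 * 'C(n, 2)%:R - (lambda0 + mu0) * m <= 0.
    rewrite -mean_affine -[leRHS]balance; apply: mean_le => x.
    exact: generator_size_ge.
  by rewrite ler_pdivrMr ?addr_gt0// mulrAC ler_pdivlMr//; lra.
- move=> a2 b2.
  have h : 0 <= lambda0 * 'C(n, 2)%:R + M * (n%:R / 2) - (lambda0 + mu0 - M * 0) * m.
    by apply: (upper 2) => // x; rewrite mul0r addr0 sum_nu2_le.
  have n1 : 0 < n%:R - 1 :> R by rewrite subr_gt0 ltr1n.
  (* Since 'C(n, 2) = n (n - 1) / 2, dividing n / 2 by the number of pairs leaves the factor 1 / (n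
     - 1) of (b). *)
  have eM : (n%:R - 1)^-1 * M * 'C(n, 2)%:R = M * (n%:R / 2).
    by rewrite bin2_natr; field; rewrite gt_eqF.
  by rewrite ler_pdivlMr ?addr_gt0// mulrAC ler_pdivrMr// mulrDl eM; lra.
- move=> a1 b1 hM.
  have h : 0 <= lambda0 * 'C(n, 2)%:R + M * 0 - (lambda0 + mu0 - M * 1) * m.
    by apply: (upper 1) => // x; rewrite add0r mul1r sum_nu1_le.
  by rewrite ler_pdivlMr ?subr_gt0// mulrAC ler_pdivrMr//; lra.
Qed.
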